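(* Let $M$ be a finite set endowed with two metrics $d_0$ and $d_1$, and let $r:M\to(0,\infty)$ be a function such that for all $x,y\in M$ $$|d_0(x,y)-d_1(x,y)|\le r(x)+r(y)\quad\text{and}\quad |r(x)-r(y)|\le d_0(x,y)+d_1(x,y).$$ Let $(M\times\mathbb{F}_2,d)$ be the generalized twisted union of $(M,d_0)$ and $(M,d_1)$ with the joining function $r(\cdot)$. Suppose that there is a constant $C>0$ such that $$d_1(x,y)\le C\,d_0(x,y)\quad\text{for all }x,y\in M.$$ Then for all $x,y\in M$ $$\frac1{2C+1}\Big(d_1(x,y)+r(x)\Big)\le d((x,0),(y,1))\le d_1(x,y)+r(x).$$ Moreover, if $r(x)=r>0$ for all $x\in M$ (i.e. the joining function is constant), then for all $x,y\in M$ $$\frac1{C+1}\Big(d_1(x,y)+r\Big)\le d((x,0),(y,1))\le d_1(x,y)+r.$$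
   Context: $\mathbb{F}_2=\{0,1\}$. Generalized twisted union: Let $M$ be a finite set endowed with two metrics $d_0,d_1$ and let $r:M\to(0,\infty)$ be a function such that $|d_0(x,y)-d_1(x,y)|\le r(x)+r(y)$ and $|r(x)-r(y)|\le d_0(x,y)+d_1(x,y)$ for all $x,y\in M$. The generalized twisted union of $(M,d_0)$ and $(M,d_1)$ with the joining function $r$ is the set $M\times\mathbb{F}_2$ with the metric $d$ defined as the shortest path metric of the weighted graph on $M\times\mathbb{F}_2$ with the following edges: for all $x,y\in M$, an edge between $(x,0)$ and $(y,0)$ of weight $d_0(x,y)$; for all $x,y\in M$, an edge between $(x,1)$ and $(y,1)$ of weight $d_1(x,y)$; for every $x\in M$, an edge between $(x,0)$ and $(x,1)$ of weight $r(x)$. *)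

(* Defs.v *)
From mathcomp Require Export all_boot all_order all_algebra.
From mathcomp Require Export boolp classical_sets reals.

Set Implicit Arguments.
Unset Strict Implicit.
Unset Printing Implicit Defensive.
Import Order.TTheory GRing.Theory Num.Theory.

Local Open Scope classical_set_scope.
Local Open Scope ring_scope.

(* A predicate rather than [metricType], since the same carrier is endowed with
   two metrics.  Nonnegativity follows from the three clauses. *)
Definition is_metric (R : realType) (T : Type) (d : T -> T -> R) : Prop :=
  [/\ forall x y, d x y = 0 <-> x = y,
      forall x y, d x y = d y x
    & forall x y z, d x z <= d x y + d y z].

(* A weighted graph on V is an adjacency relation e together with a weight
   w u v, which is only meaningful when e u v holds. *)
Section WeightedGraph.
Variables (R : realType) (V : eqType) (e : rel V) (w : V -> V -> R).

(* Total weight of the path u :: p. *)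
Definition path_weight (u : V) (p : seq V) : R := \sum_(a <- pairmap w u p) a.

(* On a connected graph with nonnegative weights, this is the infimum of a
   nonempty set bounded below by 0. *)
Definition shortest_path_dist (u v : V) : R :=
  inf [set path_weight u p | p in [set p | path e u p /\ last u p = v]].

End WeightedGraph.

Section TwistedUnion.
Variables (R : realType) (M : finType) (d0 d1 : M -> M -> R) (r : M -> R).

Definition twisted_union_adj : rel (M * 'F_2) :=
  fun u v => (u.2 == v.2) || (u.1 == v.1).

(* The last branch is reached along an edge only when u.1 = v.1. *)
Definition twisted_union_weight (u v : M * 'F_2) : R :=
  if u.2 == v.2 then (if u.2 == 0 then d0 u.1 v.1 else d1 u.1 v.1) else r u.1.

Definition twisted_union_dist : M * 'F_2 -> M * 'F_2 -> R :=
  shortest_path_dist twisted_union_adj twisted_union_weight.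

End TwistedUnion.

(* Main.v *)
Require Import Defs.
From mathcomp Require Import lra.

Set Implicit Arguments.
Unset Strict Implicit.
Unset Printing Implicit Defensive.
Import Order.TTheory GRing.Theory Num.Theory.
Local Open Scope ring_scope.

(* A function on the vertices that decreases along each edge by at most the
   weight of that edge bounds the distance to its zeros from below.  For the
   twisted union, take F (u, 0) = (d1 u y + r u) / K and F (u, 1) = d1 u y / K
   with K = 2C + 1, or K = C + 1 if r is constant; it vanishes at (y, 1). *)

Lemma potential_le_path_weight (R : realType) (V : eqType) (e : rel V)
    (w : V -> V -> R) (F : V -> R) :
  (forall u v, e u v -> F u <= w u v + F v) ->
  forall u p, path e u p -> F u <= path_weight w u p + F (last u p).
Proof.
move=> Fw u p; elim: p u => [|v p IHp] u /=.
  by rewrite /path_weight big_nil add0r.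
case/andP=> /Fw Fuv /IHp; rewrite /path_weight /= big_cons -addrA.
by move=> Fv; apply: le_trans Fuv _; rewrite lerD2l.
Qed.

Lemma shortest_path_dist_bounds (R : realType) (V : eqType) (e : rel V)
    (w : V -> V -> R) (F : V -> R) (u v : V) (p : seq V) :
  (forall a b, e a b -> F a <= w a b + F b) -> F v = 0 ->
  path e u p -> last u p = v ->
  F u <= shortest_path_dist e w u v <= path_weight w u p.
Proof.
move=> Fw Fv ep lastp; rewrite /shortest_path_dist; set S := (X in inf X).
have lbS : lbound S (F u).
  move=> _ [q [eq lastq] <-].
  by have := potential_le_path_weight Fw eq; rewrite lastq Fv addr0.
have Sp : S (path_weight w u p) by exists p.
(* The given path makes [S] nonempty and [F u] bounds it below, so [inf] is a genuine infimum here
   and not a default value. *)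
apply/andP; split; first by apply: lb_le_inf => //; exists (path_weight w u p).
by apply: ge_inf => //; exists (F u).
Qed.

Lemma is_metric_ge0 (R : realType) (T : Type) (d : T -> T -> R) :
  is_metric d -> forall x y, 0 <= d x y.
Proof.
case=> d0P dC dT x y; have := dT x y x.
by rewrite (dC y x) (proj2 (d0P x x) erefl); lra.
Qed.

(** The last hypothesis is what the potential needs along [d0] edges, once [d1 u y] is bounded by
    [d1 u v + d1 v y]; [1 <= K] serves the other edges. Both forms of the theorem follow by choosing
    [K]. *)
Lemma twisted_union_dist_bounds (R : realType) (M : finType)
    (d0 d1 : M -> M -> R) (r : M -> R) (K : R) :
  is_metric d1 -> (forall x, 0 < r x) -> 1 <= K ->
  (forall u v, d1 u v + (r u - r v) <= K * d0 u v) ->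
  forall x y,
    1 / K * (d1 x y + r x) <= twisted_union_dist d0 d1 r (x, 0) (y, 1)
    /\ twisted_union_dist d0 d1 r (x, 0) (y, 1) <= d1 x y + r x.
Proof.
move=> d1m r_gt0 K_ge1 leK x y; have [d1P _ d1T] := d1m.
have K_gt0 : 0 < K by exact: lt_le_trans ltr01 K_ge1.
pose F (u : M * 'F_2) : R :=
  1 / K * (d1 u.1 y + (if u.2 == 0 then r u.1 else 0)).
have KF u : K * F u = d1 u.1 y + (if u.2 == 0 then r u.1 else 0).
  by rewrite /F div1r mulVKf // gt_eqF.
have Fw a b : twisted_union_adj a b ->
    F a <= twisted_union_weight d0 d1 r a b + F b.
  rewrite -(ler_pM2l K_gt0) mulrDr !KF.
  case: a b => [u i] [v j]; rewrite /twisted_union_adj /twisted_union_weight /=.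
  have [<- _|neq_ij /= /eqP <-] := eqVneq i j.
    (* Edges inside a layer: [leK] and the triangle inequality in layer 0; in layer 1, the triangle
       inequality and [d1 u v <= K * d1 u v]. *)
    have := d1T u v y; have := leK u v; case: ifP => _; first lra.
    by have := ler_peMl (is_metric_ge0 d1m u v) K_ge1; lra.
  (* Edges between layers: going from layer 0 to layer 1 loses [r u <= K * r u], and the reverse
     direction increases the potential. *)
  have := ler_peMl (ltW (r_gt0 u)) K_ge1; have := r_gt0 u.
  by case: ifP => _; case: ifP => _; lra.
have Fy : F (y, 1) = 0 by rewrite /F /= (proj2 (d1P y y) erefl) addr0 mulr0.
(* The upper bound comes from crossing at [x] first and then moving inside layer 1. *)
have := @shortest_path_dist_bounds _ _ (@twisted_union_adj M) _ F (x, 0) (y, 1)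
  [:: (x, 1); (y, 1)] Fw Fy.
rewrite /path_weight /= !big_cons big_nil /twisted_union_adj /=.
rewrite /twisted_union_weight /F /= eqxx addr0 [r x + _]addrC.
by move=> /(_ isT erefl) /andP.
Qed.

Theorem lemma3p6 (R : realType) (M : finType) (d0 d1 : M -> M -> R)
    (r : M -> R) (C : R)
    (d0_metric : is_metric d0) (d1_metric : is_metric d1)
    (r_gt0 : forall x, 0 < r x)
    (dist_diff : forall x y, `|d0 x y - d1 x y| <= r x + r y)
    (r_diff : forall x y, `|r x - r y| <= d0 x y + d1 x y)
    (C_gt0 : 0 < C)
    (d1_le : forall x y, d1 x y <= C * d0 x y) :
  let d := twisted_union_dist d0 d1 r in
  (forall x y : M,
     1 / (2 * C + 1) * (d1 x y + r x) <= d (x, 0) (y, 1)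
     /\ d (x, 0) (y, 1) <= d1 x y + r x)
  /\ (forall r0 : R, 0 < r0 -> (forall x, r x = r0) ->
      forall x y : M,
        1 / (C + 1) * (d1 x y + r0) <= d (x, 0) (y, 1)
        /\ d (x, 0) (y, 1) <= d1 x y + r0).
Proof.
split=> [x y|r0 _ rE x y].
  apply: twisted_union_dist_bounds => // [|u v]; first lra.
  (* [r u - r v <= d0 u v + d1 u v] makes the left side at most [2 * d1 u v + d0 u v], whence
     [K = 2 * C + 1]. *)
  have := le_trans (ler_norm _) (r_diff u v); have := d1_le u v; lra.
rewrite -(rE x); apply: twisted_union_dist_bounds => // [|u v]; first lra.
(* The [r] terms cancel, leaving [d1 u v <= C * d0 u v]; the added 1 in [K = C + 1] ensures
   [1 <= K]. *)
by rewrite !rE; have := d1_le u v; have := is_metric_ge0 d0_metric u v; lra.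
Qed.
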